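(* The assignments $\mathcal{D}(A[[\hbar]],\wedge_A,\mathrm{d}_A)=(A[[\hbar]],\wedge_A^{\mathrm{d}_A},\mathrm{d}_A)$ on objects and $\mathcal{D}(\varphi)=\varphi$ on morphisms define a faithful functor $\mathcal{D}:\mathrm{DGA}[[\hbar]]\to\mathrm{DGA}[[\hbar]]$. Likewise, the assignment $(A,\wedge_A,\mathrm{d}_A)\mapsto (A[[\hbar]],\wedge_A^{\mathrm{d}_A},\mathrm{d}_A)$ on objects, with each morphism sent to its $\mathbb{C}[[\hbar]]$-linear extension, defines a faithful functor $\mathcal{D}:\mathrm{DGA}\to\mathrm{DGA}[[\hbar]]$.
   Context: $\mathrm{DGA}$ is the category of differential graded associative algebras $(A,\wedge_A,\mathrm{d}_A)$ over $\mathbb{C}$: $A$ is a $\mathbb{Z}$-graded vector space, $\wedge_A$ is an associative graded product and $\mathrm{d}_A$ is a $\mathbb{C}$-linear map of degree $1$ with $\mathrm{d}_A^2=0$ and $\mathrm{d}_A(a_1\wedge_A a_2)=\mathrm{d}_Aa_1\wedge_A a_2+(-1)^{|a_1|}a_1\wedge_A\mathrm{d}_Aa_2$. Its morphisms $\varphi:A\to B$ are the degree-preserving $\mathbb{C}$-linear maps with $\varphi\,\mathrm{d}_A=\mathrm{d}_B\,\varphi$ and $\varphi(a_1\wedge_A a_2)=\varphi(a_1)\wedge_B\varphi(a_2)$. The formal parameter $\hbar$ has degree $-2$. For a $\mathbb{Z}$-graded vector space $A$, $A[[\hbar]]$ is graded with this convention: its homogeneous elements of degree $k$ are the formal series $\sum_{n\ge0}\hbar^n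 a_n$ with $a_n\in A$ of degree $k+2n$. $\mathrm{DGA}[[\hbar]]$ is the category whose objects are triples $(A[[\hbar]],\wedge_A,\mathrm{d}_A)$, with $A$ a $\mathbb{Z}$-graded complex vector space, $\wedge_A$ a $\mathbb{C}[[\hbar]]$-bilinear associative graded product on $A[[\hbar]]$, and $\mathrm{d}_A$ a $\mathbb{C}[[\hbar]]$-linear degree $1$ map with $\mathrm{d}_A^2=0$ satisfying the graded Leibniz rule for $\wedge_A$; its morphisms are the degree-preserving $\mathbb{C}[[\hbar]]$-linear maps intertwining differentials and products. The deformed product is $a_1\wedge^{\mathrm{d}}a_2=a_1\wedge a_2+\mathrm{i}\hbar(-1)^{|a_1|}\,\mathrm{d}a_1\wedge\mathrm{d}a_2$ for homogeneous $a_1,a_2$, where $\mathrm{i}=\sqrt{-1}$. For an object of $\mathrm{DGA}$ the product $\wedge_A$ and differential $\mathrm{d}_A$ are first extended to $A[[\hbar]]$ in the $\mathbb{C}[[\hbar]]$-(bi)linear way. *)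

(* Defs.v *)
From HB Require Import structures.
From mathcomp Require Import all_boot all_order all_algebra.
From mathcomp Require Import boolp classical_sets functions cardinality fsbigop.
From mathcomp Require Import reals.
From mathcomp.real_closed Require Import complex.

Set Implicit Arguments.
Unset Strict Implicit.
Unset Printing Implicit Defensive.

Import GRing.Theory.
Local Open Scope ring_scope.

(** * Formal power series in hbar *)

(** [fps V] is V[[hbar]]: the series sum_n hbar^n (a n) is the sequence [a]. *)
Definition fps (V : Type) : Type := nat -> V.

Definition cauchy (U V : Type) (W : nmodType) (op : U -> V -> W)
    (a : fps U) (b : fps V) : fps W :=
  fun n => \sum_(i < n.+1) op (a i) (b (n - i)%N).

HB.instance Definition _ (V : zmodType) := GRing.Zmodule.copy (fps V) (nat -> V).

Lemma fpsDE (V : zmodType) (a b : fps V) n : (a + b) n = a n + b n.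
Proof. by []. Qed.

Section CauchyTheory.

Lemma cauchyDl (U V W : zmodType) (op : U -> V -> W) :
  (forall b, {morph op^~ b : x y / x + y}) ->
  forall b, {morph (cauchy op)^~ b : x y / x + y}.
Proof.
move=> opD b x y; apply/funext => n; rewrite fpsDE /cauchy -big_split /=.
by apply: eq_bigr => i _; rewrite fpsDE opD.
Qed.

Lemma cauchyDr (U V W : zmodType) (op : U -> V -> W) :
  (forall a, {morph op a : x y / x + y}) ->
  forall a, {morph cauchy op a : x y / x + y}.
Proof.
move=> opD a x y; apply/funext => n; rewrite fpsDE /cauchy -big_split /=.
by apply: eq_bigr => i _; rewrite fpsDE opD.
Qed.

Lemma cauchyA (U V W UV VW X : zmodType) (o1 : U -> V -> UV)
    (o2 : UV -> W -> X) (o3 : V -> W -> VW) (o4 : U -> VW -> X) :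
  (forall c, {morph o2^~ c : x y / x + y}) ->
  (forall a, {morph o4 a : x y / x + y}) ->
  (forall a b c, o4 a (o3 b c) = o2 (o1 a b) c) ->
  forall a b c, cauchy o4 a (cauchy o3 b c) = cauchy o2 (cauchy o1 a b) c.
Proof.
move=> o2D o4D oA a b c; apply/funext => n; rewrite /cauchy.
have o20 z : o2 0 z = 0.
  by apply: (addrI (o2 0 z)); rewrite -o2D !addr0.
have o40 z : o4 z 0 = 0.
  by apply: (addrI (o4 z 0)); rewrite -o4D !addr0.
pose F (j k : nat) := o4 (a j) (o3 (b (n - j - k)%N) (c k)).
transitivity (\sum_(j < n.+1) \sum_(k < n.+1 | (k <= n - j)%N) F j k).
  apply: eq_bigr => j _; rewrite (big_morph _ (o4D (a j)) (o40 _)).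
  rewrite (reindex_inj rev_ord_inj) /= (big_ord_narrow_leq (leq_subr _ _)).
  apply: eq_bigr => k _; rewrite /F /= subSS; congr (o4 _ (o3 _ (c _))).
  by rewrite subKn // -ltnS.
rewrite (exchange_big_dep predT) //= (reindex_inj rev_ord_inj) /=.
apply: eq_bigr => i _; rewrite subSS (big_morph _ (o2D _) (o20 _)).
transitivity (\sum_(j < n.+1 | (j <= i)%N) F j (n - i)%N).
  apply: eq_bigl => j; have := ltn_ord i; have := ltn_ord j.
  by rewrite !ltnS => jn ni; rewrite leq_sub2lE.
have ile : (i <= n)%N by rewrite -ltnS.
rewrite (big_ord_narrow_leq ile); apply: eq_bigr => j _ /=.
rewrite /F oA; congr (o2 (o1 _ (b _)) _).
by rewrite subnAC subKn.
Qed.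

End CauchyTheory.

Definition fpsC (V : nmodType) (c : V) : fps V := fun n => if n == 0%N then c else 0.

Lemma cauchy_fpsCl (U : nmodType) (V W : zmodType) (op : U -> V -> W) c a :
  (forall y, op 0 y = 0) -> cauchy op (fpsC c) a = fun n => op c (a n).
Proof.
move=> op0; apply/funext => n; rewrite /cauchy big_ord_recl /= subn0.
by rewrite big1 ?addr0 // => i _; rewrite op0.
Qed.

Section FpsRing.
Variable K : comNzRingType.
Implicit Types a b c : fps K.

Definition fps_one : fps K := fpsC 1.
Definition fps_mul : fps K -> fps K -> fps K := cauchy *%R.

Fact fps_mulA : associative fps_mul.
Proof.
apply: cauchyA => [c x y|a x y|a b c]; [exact: mulrDl|exact: mulrDr|].
exact: mulrA.
Qed.

Fact fps_mulC : commutative fps_mul.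
Proof.
move=> a b; apply/funext => n; rewrite /fps_mul /cauchy.
rewrite (reindex_inj rev_ord_inj) /=; apply: eq_bigr => i _.
have ile : (i <= n)%N by rewrite -ltnS.
by rewrite subSS (subKn ile) [LHS]mulrC.
Qed.

Fact fps_mul1 : left_id fps_one fps_mul.
Proof.
move=> a; rewrite /fps_mul cauchy_fpsCl; last by move=> y; rewrite mul0r.
by apply/funext => n; rewrite mul1r.
Qed.

Fact fps_mulDl : left_distributive fps_mul +%R.
Proof. by move=> a b c; apply: cauchyDl => d x y; rewrite mulrDl. Qed.

Fact fps_one_neq0 : fps_one != 0.
Proof.
by apply/eqP => /(congr1 (fun f : fps K => f 0%N)) /= /eqP; rewrite oner_eq0.
Qed.

HB.instance Definition _ := GRing.Zmodule_isComNzRing.Build (fps K)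
  fps_mulA fps_mulC fps_mul1 fps_mulDl fps_one_neq0.

Definition hbar : fps K := fun n => (n == 1%N)%:R.

End FpsRing.

Section FpsModule.
Variables (K : comNzRingType) (V : lmodType K).

Definition fps_scale : fps K -> fps V -> fps V := cauchy *:%R.

Fact fps_scaleA a b v : fps_scale a (fps_scale b v) = fps_scale (a * b) v.
Proof.
apply: cauchyA => [c x y|c x y|c x y]; [exact: scalerDl|exact: scalerDr|].
exact: scalerA.
Qed.

Fact fps_scale1 : left_id 1 fps_scale.
Proof.
move=> a; rewrite /fps_scale [LHS]cauchy_fpsCl; last first.
  by move=> y; rewrite scale0r.
by apply/funext => n; rewrite scale1r.
Qed.

Fact fps_scaleDr : right_distributive fps_scale +%R.
Proof. by move=> a; apply: cauchyDr => c x y; rewrite scalerDr. Qed.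

Fact fps_scaleDl v : {morph fps_scale^~ v : a b / a + b}.
Proof. by apply: cauchyDl => c x y; rewrite scalerDl. Qed.

HB.instance Definition _ := GRing.Zmodule_isLmodule.Build (fps K) (fps V)
  fps_scaleA fps_scale1 fps_scaleDr fps_scaleDl.

End FpsModule.

(** * Graded vector spaces *)

Section GradedSpaces.
Variable K : fieldType.

(** A vector space that is the internal direct sum of the subspaces
    [gpart k], k in Z; no boundedness or finite-dimensionality. *)
Record gradedSpace := GradedSpace {
  gsort :> lmodType K;
  gpart : int -> {pred gsort};
  gpart_submod : forall k, submod_closed (gpart k);
  gpart_direct : forall v : gsort, exists! f : int -> gsort,
    [/\ forall k, f k \in gpart k,
        finite_set [set k | f k != 0] &
        v = \sum_(k \in [set: int]) f k]
}.
Arguments gpart : clear implicits.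

Definition gcomp (A : gradedSpace) (v : A) : int -> A :=
  sval (cid (gpart_direct v)).

(** The linear involution equal to (-1)^k on degree k; it gives a meaning to
    the sign (-1)^|v| for v not homogeneous. *)
Definition gsgn (A : gradedSpace) (v : A) : A :=
  \sum_(k \in [set: int]) (-1) ^+ `|k|%N *: gcomp v k.

(** Since hbar has degree -2, a series is homogeneous of degree k when its
    n-th coefficient is homogeneous of degree k + 2n. *)
Definition hpart (A : gradedSpace) (k : int) (a : fps A) : Prop :=
  forall n : nat, a n \in gpart A (k + (n.*2)%:Z).

(** As hbar has even degree, the sign involution acts coefficientwise. *)
Definition hsgn (A : gradedSpace) (a : fps A) : fps A := fun n => gsgn (a n).

Lemma gcomp_homog (A : gradedSpace) (k : int) (v : A) :
  v \in gpart A k -> gcomp v = fun j => if j == k then v else 0.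
Proof.
move=> vk; rewrite /gcomp; case: cid => f /= [_ funiq]; apply: funiq; split.
- by move=> j; case: eqP => [->//|_]; case: (gpart_submod A j).
- apply: (@sub_finite_set _ _ [set k]%classic) => [j /=|]; last exact: finite_set1.
  by case: (j =P k) => // _; rewrite eqxx.
- rewrite -(@fsbig_widen _ _ 0 +%R [set k]%classic) ?fsbig_set1 ?eqxx //.
  by move=> j /= [_]; case: (j =P k).
Qed.

Lemma gsgn_homog (A : gradedSpace) (k : int) (v : A) :
  v \in gpart A k -> gsgn v = (-1) ^+ `|k|%N *: v.
Proof.
move=> vk; rewrite /gsgn (gcomp_homog vk).
rewrite -(@fsbig_widen _ _ 0 +%R [set k]%classic) ?fsbig_set1 ?eqxx //.
by move=> j /= [_]; case: (j =P k) => // _; rewrite scaler0.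
Qed.

Lemma fpsC_scaleE (A : gradedSpace) (c : K) (a : fps A) :
  fpsC c *: a = fun n => c *: a n.
Proof. by rewrite [LHS]cauchy_fpsCl // => y; rewrite scale0r. Qed.

Lemma fps_signE (j : nat) : (-1) ^+ j = fpsC ((-1) ^+ j) :> fps K.
Proof.
elim: j => [//|j IHj]; rewrite exprS IHj mulN1r exprS mulN1r.
by apply/funext => -[|n] //; rewrite /fpsC /= -[LHS]/(- 0) oppr0.
Qed.

Lemma hsgn_homog (A : gradedSpace) (k : int) (a : fps A) :
  hpart k a -> hsgn a = (-1) ^+ `|k|%N *: a.
Proof.
move=> ak; rewrite fps_signE fpsC_scaleE.
apply/funext => n; rewrite /hsgn (gsgn_homog (ak n)); congr (_ *: _).
rewrite -signr_odd -[RHS]signr_odd; congr (_ ^+ nat_of_bool _).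
have eZ (m : int) : odd `|m|%N = ~~ (2 %| m)%Z by rewrite dvdzE dvdn2 negbK.
rewrite !eZ; congr (~~ _); rewrite -muln2 PoszM.
by rewrite rpredDr ?dvdz_mull.
Qed.

End GradedSpaces.
Arguments gpart {K} g _.

(** * Categories *)

Record category := Category {
  obj :> Type;
  mor : obj -> obj -> Type;
  idm : forall A, mor A A;
  compm : forall A B C, mor B C -> mor A B -> mor A C;
  compmA : forall A B C D (h : mor C D) (g : mor B C) (f : mor A B),
    compm h (compm g f) = compm (compm h g) f;
  comp1m : forall A B (f : mor A B), compm (idm B) f = f;
  compm1 : forall A B (f : mor A B), compm f (idm A) = f
}.
Arguments idm {c} A.
Arguments compm {c A B C}.

Record is_functor (C D : category) (F0 : C -> D)
    (F1 : forall A B : C, mor A B -> mor (F0 A) (F0 B)) : Prop := IsFunctor {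
  functor_id : forall A : C, F1 A A (idm A) = idm (F0 A);
  functor_comp : forall (X Y Z : C) (g : mor Y Z) (f : mor X Y),
    F1 X Z (compm g f) = compm (F1 Y Z g) (F1 X Y f)
}.

Definition is_faithful (C D : category) (F0 : C -> D)
    (F1 : forall A B : C, mor A B -> mor (F0 A) (F0 B)) : Prop :=
  forall A B : C, injective (F1 A B).

(** * Differential graded algebras *)

Section DGA.
Variable R : realType.
Local Notation C := R[i].

(** No unit is required. *)
Record dga_data := DgaData {
  dga_sp : gradedSpace C;
  dga_mul : dga_sp -> dga_sp -> dga_sp;
  dga_d : dga_sp -> dga_sp
}.

Record is_dga (A : dga_data) : Prop := IsDga {
  dga_mul_linearl : forall b, linear (fun a => @dga_mul A a b);
  dga_mul_linearr : forall a, linear (@dga_mul A a);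
  dga_mul_homog : forall p q a b, a \in gpart (dga_sp A) p ->
    b \in gpart (dga_sp A) q -> dga_mul a b \in gpart (dga_sp A) (p + q);
  dga_mulA : associative (@dga_mul A);
  dga_d_linear : linear (@dga_d A);
  dga_d_homog : forall p a, a \in gpart (dga_sp A) p ->
    dga_d a \in gpart (dga_sp A) (p + 1);
  dga_dd : forall a, dga_d (@dga_d A a) = 0;
  dga_leibniz : forall p a b, a \in gpart (dga_sp A) p ->
    dga_d (dga_mul a b) =
    dga_mul (dga_d a) b + (-1) ^+ `|p|%N *: @dga_mul A a (dga_d b)
}.

Record dga := Dga { dga_dataOf :> dga_data; dgaP : is_dga dga_dataOf }.

Record is_dga_hom (A B : dga_data) (f : dga_sp A -> dga_sp B) : Prop :=
  IsDgaHom {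
  dga_hom_linear : linear f;
  dga_hom_homog : forall p a, a \in gpart (dga_sp A) p ->
    f a \in gpart (dga_sp B) p;
  dga_hom_d : forall a, f (dga_d a) = dga_d (f a);
  dga_hom_mul : forall a b, f (dga_mul a b) = dga_mul (f a) (f b)
}.

Record dga_hom (A B : dga) := DgaHom {
  dga_fun :> dga_sp A -> dga_sp B;
  dga_funP : is_dga_hom dga_fun
}.

Lemma dga_hom_ext (A B : dga) (f g : dga_hom A B) :
  (f : dga_sp A -> dga_sp B) = g -> f = g.
Proof.
case: f g => [f fP] [g gP] /= e; rewrite -e in gP *.
by congr DgaHom; exact: Prop_irrelevance.
Qed.

Fact is_dga_hom_id (A : dga) : is_dga_hom (@id (dga_sp A)).
Proof. by split. Qed.

Fact is_dga_hom_comp (X Y Z : dga) (g : dga_hom Y Z) (f : dga_hom X Y) :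
  is_dga_hom (fun a => g (f a)).
Proof.
case: f g => [f [f1 f2 f3 f4]] [g [g1 g2 g3 g4]] /=; split.
- by move=> c u v; rewrite f1 g1.
- by move=> p a /f2 /g2.
- by move=> a; rewrite f3 g3.
- by move=> a b; rewrite f4 g4.
Qed.

Definition DGA : category.
Proof.
refine (@Category dga dga_hom (fun A => DgaHom (is_dga_hom_id A))
  (fun X Y Z g f => DgaHom (is_dga_hom_comp g f)) _ _ _).
- by move=> *; apply: dga_hom_ext.
- by move=> *; apply: dga_hom_ext.
- by move=> *; apply: dga_hom_ext.
Defined.

(** The underlying C[[hbar]]-module of an object of DGA[[hbar]] is
    [fps (dgah_sp A)]; [linear] below means C[[hbar]]-linear. *)
Record dgah_data := DgahData {
  dgah_sp : gradedSpace C;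
  dgah_mul : fps dgah_sp -> fps dgah_sp -> fps dgah_sp;
  dgah_d : fps dgah_sp -> fps dgah_sp
}.

Record is_dgah (A : dgah_data) : Prop := IsDgah {
  dgah_mul_linearl : forall b, linear (fun a => @dgah_mul A a b);
  dgah_mul_linearr : forall a, linear (@dgah_mul A a);
  dgah_mul_homog : forall p q (a b : fps (dgah_sp A)),
    hpart p a -> hpart q b -> hpart (p + q) (dgah_mul a b);
  dgah_mulA : associative (@dgah_mul A);
  dgah_d_linear : linear (@dgah_d A);
  dgah_d_homog : forall p (a : fps (dgah_sp A)),
    hpart p a -> hpart (p + 1) (dgah_d a);
  dgah_dd : forall a, dgah_d (@dgah_d A a) = 0;
  dgah_leibniz : forall p (a b : fps (dgah_sp A)), hpart p a ->
    dgah_d (dgah_mul a b) =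
    dgah_mul (dgah_d a) b + (-1) ^+ `|p|%N *: dgah_mul a (dgah_d b)
}.

Record dgah := Dgah { dgah_dataOf :> dgah_data; dgahP : is_dgah dgah_dataOf }.

Record is_dgah_hom (A B : dgah_data) (f : fps (dgah_sp A) -> fps (dgah_sp B))
    : Prop := IsDgahHom {
  dgah_hom_linear : linear f;
  dgah_hom_homog : forall p a, hpart p a -> hpart p (f a);
  dgah_hom_d : forall a, f (dgah_d a) = dgah_d (f a);
  dgah_hom_mul : forall a b, f (dgah_mul a b) = dgah_mul (f a) (f b)
}.

Record dgah_hom (A B : dgah) := DgahHom {
  dgah_fun :> fps (dgah_sp A) -> fps (dgah_sp B);
  dgah_funP : is_dgah_hom dgah_fun
}.

Lemma dgah_hom_ext (A B : dgah) (f g : dgah_hom A B) :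
  (f : fps (dgah_sp A) -> fps (dgah_sp B)) = g -> f = g.
Proof.
case: f g => [f fP] [g gP] /= e; rewrite -e in gP *.
by congr DgahHom; exact: Prop_irrelevance.
Qed.

Fact is_dgah_hom_id (A : dgah) : is_dgah_hom (@id (fps (dgah_sp A))).
Proof. by split. Qed.

Fact is_dgah_hom_comp (X Y Z : dgah) (g : dgah_hom Y Z) (f : dgah_hom X Y) :
  is_dgah_hom (fun a => g (f a)).
Proof.
case: f g => [f [f1 f2 f3 f4]] [g [g1 g2 g3 g4]] /=; split.
- by move=> c u v; rewrite f1 g1.
- by move=> p a /f2 /g2.
- by move=> a; rewrite f3 g3.
- by move=> a b; rewrite f4 g4.
Qed.

Definition DGAh : category.
Proof.
refine (@Category dgah dgah_hom (fun A => DgahHom (is_dgah_hom_id A))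
  (fun X Y Z g f => DgahHom (is_dgah_hom_comp g f)) _ _ _).
- by move=> *; apply: dgah_hom_ext.
- by move=> *; apply: dgah_hom_ext.
- by move=> *; apply: dgah_hom_ext.
Defined.

(** * The deformed product *)

Definition ihbar : fps C := fpsC 'i%C * hbar C.

(** [deform_mulE] gives the usual formula on homogeneous elements. *)
Definition deform_mul (A : dgah_data) (a b : fps (dgah_sp A)) :
    fps (dgah_sp A) :=
  dgah_mul a b + ihbar *: dgah_mul (dgah_d (hsgn a)) (dgah_d b).

Definition deform (A : dgah_data) : dgah_data :=
  DgahData (@deform_mul A) (@dgah_d A).

Lemma deform_mulE (A : dgah) (k : int) (a b : fps (dgah_sp A)) :
  hpart k a ->
  deform_mul a b = dgah_mul a b +
    (ihbar * (-1) ^+ `|k|%N) *: dgah_mul (dgah_d a) (dgah_d b).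
Proof.
move=> ak; rewrite /deform_mul (hsgn_homog ak).
have linZ (U V : lmodType (fps C)) (f : U -> V) : linear f ->
    forall c x, f (c *: x) = c *: f x.
  move=> lf c x; have f0 : f 0 = 0.
    by have := lf (-1) 0 0; rewrite scaleN1r oppr0 addr0 scaleN1r addNr.
  by have := lf c x 0; rewrite f0 !addr0.
rewrite (linZ _ _ _ (dgah_d_linear (dgahP A))).
by rewrite (linZ _ _ _ (dgah_mul_linearl (dgahP A) _)) scalerA.
Qed.

(** * Extension of scalars *)

(** The C[[hbar]]-linear extension of a linear map. *)
Definition fps_map (U V : Type) (f : U -> V) (a : fps U) : fps V :=
  fun n => f (a n).

(** The C[[hbar]]-bilinear extension of the product is the Cauchy product. *)
Definition extend (A : dga_data) : dgah_data :=
  @DgahData (dga_sp A) (cauchy (@dga_mul A)) (fps_map (@dga_d A)).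

End DGA.

(* Main.v *)
Require Import Defs.
From HB Require Import structures.
From mathcomp Require Import all_boot all_algebra zify finmap.
From mathcomp Require Import boolp classical_sets cardinality fsbigop.
From mathcomp Require Import reals.
From mathcomp.real_closed Require Import complex.

Set Implicit Arguments.
Unset Strict Implicit.
Unset Printing Implicit Defensive.

Import GRing.Theory.
Local Open Scope ring_scope.

(** Why the theorem is true.

    Write s for the involution equal to (-1)^k in degree k, so that the deformed
    product is a * b = ab + i hbar d(s a) d b for all series a, b, homogeneous
    or not.  The computation rests on the identities
      d(ab) = (d a) b + (s a)(d b),  s(ab) = (s a)(s b),  s d = - d s,  s s = 1,
    together with d d = 0.  They imply that d kills the product of two exact
    elements, hence d(a * b) = d(ab) and, as d s = - s d, d s (a * b) = d s (ab):
    the hbar^2 terms of (a * b) * c and a * (b * c) vanish, and both sides equal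
      abc + i hbar (d(s a) (d b) c + d(s a) (s b) (d c) + a d(s b) (d c)).
    The deformed Leibniz rule reduces to the original one because the
    correction terms of (d a) * b and a * (d b) contain d d.  The correction
    has degree 0 since d has degree 1 twice and hbar has degree -2.  A morphism
    commutes with d and, preserving degrees, with s; so it respects the deformed
    product too.

    The axioms give these identities for homogeneous series only, and a series
    need not be a finite sum of homogeneous ones, since infinitely many
    degrees may occur in it.  What saves the argument is that a
    C[[hbar]]-linear map is automatically hbar-adically continuous: its n-th
    coefficient depends on finitely many coefficients of the argument, each a
    finite sum of homogeneous vectors.  So C[[hbar]]-linear maps that agree on
    homogeneous series are equal ([eq_linear_hpart]).

    For the second functor, the Cauchy product and the coefficientwise
    differential make A[[hbar]] an object of DGA[[hbar]] ([extend_is_dgah]), and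
    coefficientwise application of a morphism is a morphism; composing with the
    first functor gives the claim.  Faithfulness is clear for the first functor,
    and for the second a map is recovered from its extension through the
    constant series. *)

(** * Linear maps and finitely supported sums *)

Lemma linear_additive (K : nzRingType) (U V : lmodType K) (f : U -> V) :
  linear f -> {morph f : x y / x + y}.
Proof. by move=> lf x y; have := lf 1 x y; rewrite !scale1r. Qed.

Lemma additive_zero (U V : zmodType) (f : U -> V) :
  {morph f : x y / x + y} -> f 0 = 0.
Proof. by move=> fD; apply: (addrI (f 0)); rewrite -fD !addr0. Qed.

Lemma linear_zero (K : nzRingType) (U V : lmodType K) (f : U -> V) :
  linear f -> f 0 = 0.
Proof. by move=> /linear_additive/additive_zero. Qed.

(** Although the absolute value is not additive, its parity is. *)
Lemma sign_abszD (K : nzRingType) (p q : int) :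
  (-1) ^+ `|(p + q)%R|%N = (-1) ^+ `|p|%N * (-1) ^+ `|q|%N :> K.
Proof.
rewrite -exprD -signr_odd -[RHS]signr_odd; congr (_ ^+ nat_of_bool _).
by lia.
Qed.

Lemma fsumr_additive (I : choiceType) (U V : zmodType) (h : U -> V)
    (F : I -> U) :
  {morph h : x y / x + y} -> finite_set [set i | F i != 0] ->
  h (\sum_(i \in [set: I]) F i) = \sum_(i \in [set: I]) h (F i).
Proof.
move=> hD finF; have h0 := additive_zero hD.
have out (W : zmodType) (G : I -> W) : (forall i, F i = 0 -> G i = 0) ->
    \sum_(i \in [set: I]) G i = \sum_(i <- fset_set [set i | F i != 0]) G i.
  move=> G0; apply: fsbigTE => i; rewrite in_fset_set // notin_setE /=.
  by move=> /negP; rewrite negbK => /eqP/G0.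
rewrite (out _ F) // (out _ (h \o F)) => [|i /= ->//].
by rewrite (big_morph _ hD h0).
Qed.

Lemma fsumr_linear (I : choiceType) (K : nzRingType) (V : lmodType K) (c : K)
    (F G : I -> V) :
  finite_set [set i | F i != 0] -> finite_set [set i | G i != 0] ->
  \sum_(i \in [set: I]) (c *: F i + G i) =
  c *: (\sum_(i \in [set: I]) F i) + \sum_(i \in [set: I]) G i.
Proof.
move=> finF finG; pose D := ([set i | F i != 0] `|` [set i | G i != 0])%classic.
have finD : finite_set D by rewrite /D finite_setU.
have out (H : I -> V) : (forall i, F i = 0 -> G i = 0 -> H i = 0) ->
    \sum_(i \in [set: I]) H i = \sum_(i <- fset_set D) H i.
  move=> H0; apply: fsbigTE => i; rewrite in_fset_set // notin_setE /=.
  by move=> /not_orP[/negP/negPn/eqP F0 /negP/negPn/eqP]; apply: H0.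
rewrite (out F) // (out G) // (out (fun i => c *: F i + G i)).
  by rewrite big_split scaler_sumr.
by move=> i -> ->; rewrite scaler0 addr0.
Qed.

(** * The Cauchy product of series *)

Lemma cauchy_flip (U V : Type) (W : nmodType) (op : U -> V -> W)
    (a : fps U) (b : fps V) : cauchy op a b = cauchy (fun y x => op x y) b a.
Proof.
apply/funext => n; rewrite /cauchy (reindex_inj rev_ord_inj) /=.
by apply: eq_bigr => i _; rewrite subSS subKn // -ltnS.
Qed.

(** Moving a scalar past the first factor is associativity of Cauchy products,
    once the products are read with their arguments exchanged. *)
Lemma cauchy_linearr (K : comNzRingType) (U V W : lmodType K)
    (op : U -> V -> W) : (forall a, linear (op a)) ->
  forall a : fps U, linear (cauchy op a : fps V -> fps W).
Proof.
move=> opr a c x y.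
rewrite (cauchyDr (fun u => linear_additive (opr u))); congr (_ + _).
rewrite [cauchy op a (c *: x)]cauchy_flip [cauchy op a x]cauchy_flip.
symmetry; apply: cauchyA => [z u v|k u v|k u v].
- exact: linear_additive.
- exact: scalerDr.
- by rewrite (scalable_linear (opr _)).
Qed.

Lemma cauchy_linearl (K : comNzRingType) (U V W : lmodType K)
    (op : U -> V -> W) : (forall b, linear (op^~ b)) ->
  forall b : fps V, linear ((cauchy op)^~ b : fps U -> fps W).
Proof.
move=> opl b c x y; rewrite !(cauchy_flip op).
exact: cauchy_linearr.
Qed.

(** * Series over graded spaces and the sign involution *)

Section Graded.
Variable K : fieldType.
Implicit Types A B : gradedSpace K.

HB.instance Definition _ A k :=
  GRing.isSubmodClosed.Build K A (gpart A k) (@gpart_submod K A k).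

Lemma gcompP A (v : A) :
  [/\ forall k, gcomp v k \in gpart A k,
      finite_set [set k | gcomp v k != 0] &
      v = \sum_(k \in [set: int]) gcomp v k].
Proof. by rewrite /gcomp; case: cid => f []. Qed.

Lemma gcomp_uniq A (v : A) (f : int -> A) :
  (forall k, f k \in gpart A k) -> finite_set [set k | f k != 0] ->
  v = \sum_(k \in [set: int]) f k -> gcomp v = f.
Proof. by move=> *; rewrite /gcomp; case: cid => g /= [_]; apply. Qed.

Lemma gcomp_linear A (c : K) (u v : A) :
  gcomp (c *: u + v) = fun k => c *: gcomp u k + gcomp v k.
Proof.
have [uh uf us] := gcompP u; have [vh vf vs] := gcompP v.
apply: gcomp_uniq => [k|| ]; first by rewrite rpredD ?rpredZ.
  apply: sub_finite_set (_ : finite_set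
    ([set k | gcomp u k != 0] `|` [set k | gcomp v k != 0])%classic).
    move=> k /=; case: (eqVneq (gcomp u k) 0) => [->|]; last by left.
    by rewrite scaler0 add0r; right.
  by rewrite finite_setU.
by rewrite fsumr_linear // -us -vs.
Qed.

Lemma gsgn_linear A : linear (@gsgn K A).
Proof.
have fin (v : A) : finite_set [set k | (-1) ^+ `|k|%N *: gcomp v k != 0].
  have [_ vf _] := gcompP v; apply: sub_finite_set vf => k /=.
  by apply: contra_neq => ->; rewrite scaler0.
move=> c u v; rewrite /gsgn gcomp_linear -fsumr_linear //.
by apply: eq_fsbigr => k _; rewrite scalerDr !scalerA mulrC.
Qed.

Lemma fps_scaleE (V : lmodType K) (c : fps K) (a : fps V) n :
  (c *: a) n = \sum_(i < n.+1) c i *: a (n - i)%N.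
Proof. by []. Qed.

Lemma fps_map_linear (U V : lmodType K) (f : U -> V) :
  linear f -> linear (fps_map f : fps U -> fps V).
Proof.
move=> lf c x y; apply/funext => n; rewrite /fps_map !fpsDE.
rewrite (linear_additive lf) !fps_scaleE.
rewrite (big_morph _ (linear_additive lf) (linear_zero lf)); congr (_ + _).
by apply: eq_bigr => i _; rewrite (scalable_linear lf).
Qed.

Lemma hbar_scaleE (V : lmodType K) (a : fps V) n :
  (hbar K *: a) n = if n is m.+1 then a m else 0.
Proof.
rewrite fps_scaleE big_ord_recl scale0r add0r.
case: n => [|n]; first by rewrite big_ord0.
rewrite big_ord_recl scale1r big1 ?addr0 ?subSS ?subn0 // => i _.
by rewrite scale0r.
Qed.

Lemma fps_split (V : lmodType K) (a : fps V) :
  a = fpsC (a 0%N) + hbar K *: ((fun n => a n.+1) : fps V).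
Proof.
apply/funext => n; rewrite fpsDE hbar_scaleE.
by case: n => [|n]; rewrite /fpsC /= ?addr0 ?add0r.
Qed.

Lemma hpart_fpsC A k (v : A) : v \in gpart A k -> hpart k (fpsC v).
Proof. by move=> vk [|n]; rewrite /fpsC /= ?addr0 ?rpred0. Qed.

Lemma fpsC_additive (V : zmodType) : {morph @fpsC V : x y / x + y}.
Proof.
by move=> x y; apply/funext => -[|n] //=; rewrite fpsDE /fpsC /= addr0.
Qed.

(** Linearity over the power series makes the n-th coefficient of [f a] depend
    on the first n+1 coefficients of [a] only: splitting off the constant term,
    the rest is divisible by hbar and one recurses on n.  On constants the
    decomposition into finitely many homogeneous components applies. *)
Lemma eq_linear_hpart A (V : lmodType K) (f g : fps A -> fps V) :
  linear f -> linear g -> (forall k a, hpart k a -> f a = g a) -> f =1 g.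
Proof.
move=> lf lg fg a; pose h := f \- g.
have lh : linear h.
  by move=> c x y; rewrite /h /= lf lg scalerBr opprD addrACA.
suff h0 n b : h b n = 0 by apply/subr0_eq/funext => n; apply: (h0 n a).
have hC v : h (fpsC v) = 0.
  have [vh vf vs] := gcompP v; rewrite vs.
  have hCD : {morph h \o @fpsC A : x y / x + y}.
    by move=> x y; rewrite /= fpsC_additive (linear_additive lh).
  rewrite -[LHS]/((h \o @fpsC A) _) (fsumr_additive hCD vf) fsbig1 // => k _.
  by rewrite /h /= (fg k) ?subrr //; apply: hpart_fpsC.
elim: n b => [|n IHn] b; rewrite (fps_split b) (linear_additive lh) hC add0r;
  by rewrite (scalable_linear lh) /= hbar_scaleE.
Qed.

Lemma hsgn_linear A : linear (@hsgn K A).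
Proof. exact/fps_map_linear/gsgn_linear. Qed.

HB.instance Definition _ A :=
  GRing.isLinear.Build (fps K) (fps A) (fps A) _ (@hsgn K A) (@hsgn_linear A).

Lemma hpartN A k (a : fps A) (n : nat) : hpart k a -> hpart k ((-1) ^+ n *: a).
Proof. by move=> ak m; rewrite fps_signE fpsC_scaleE rpredZ. Qed.

Lemma hsgnK A : involutive (@hsgn K A).
Proof.
apply: eq_linear_hpart => // [c x y|k a ak]; first by rewrite !linearP.
rewrite (hsgn_homog ak) linearZZ /= (hsgn_homog ak) scalerA.
by rewrite -expr2 sqrr_sign scale1r.
Qed.

(** Applied to differentials (e = 1) and to morphisms (e = 0). *)
Lemma hsgn_degree A B (e : int) (f : {linear fps A -> fps B}) :
  (forall p a, hpart p a -> hpart (p + e) (f a)) ->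
  forall a, hsgn (f a) = (-1) ^+ `|e|%N *: f (hsgn a).
Proof.
move=> fe; apply: eq_linear_hpart => [c x y|c x y|k a ak].
- by rewrite !linearP.
- by rewrite hsgn_linear linearPZ scalerDr !scalerA mulrC.
rewrite (hsgn_homog (fe _ _ ak)) (hsgn_homog ak) linearZZ.
by rewrite sign_abszD scalerA mulrC.
Qed.
End Graded.

(** * The deformed algebra *)

Section Deform.
Variable R : realType.
Local Notation C := R[i].
Implicit Type A : dgah R.

HB.instance Definition _ A :=
  GRing.isLinear.Build (fps C) (fps (dgah_sp A)) (fps (dgah_sp A)) _
    (@dgah_d R A) (dgah_d_linear (dgahP A)).

HB.instance Definition _ A (a : fps (dgah_sp A)) :=
  GRing.isLinear.Build (fps C) (fps (dgah_sp A)) (fps (dgah_sp A)) _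
    (@dgah_mul R A a) (dgah_mul_linearr (dgahP A) a).

HB.instance Definition _ (A B : dgah R) (f : dgah_hom A B) :=
  GRing.isLinear.Build (fps C) (fps (dgah_sp A)) (fps (dgah_sp B)) _
    (dgah_fun f) (dgah_hom_linear (dgah_funP f)).

Lemma dgah_mulDl A (x y b : fps (dgah_sp A)) :
  dgah_mul (x + y) b = dgah_mul x b + dgah_mul y b.
Proof. exact: (linear_additive (dgah_mul_linearl (dgahP A) b)). Qed.

Lemma dgah_mulZl A c (x b : fps (dgah_sp A)) :
  dgah_mul (c *: x) b = c *: dgah_mul x b.
Proof. exact: (scalable_linear (dgah_mul_linearl (dgahP A) b)). Qed.

Lemma dgah_mul0l A (b : fps (dgah_sp A)) : dgah_mul 0 b = 0.
Proof. exact: (linear_zero (dgah_mul_linearl (dgahP A) b)). Qed.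

Lemma hsgn_d A (a : fps (dgah_sp A)) : hsgn (dgah_d a) = - dgah_d (hsgn a).
Proof. by rewrite (hsgn_degree (dgah_d_homog (dgahP A))) expr1 scaleN1r. Qed.

Lemma hsgn_mul A (a b : fps (dgah_sp A)) :
  hsgn (dgah_mul a b) = dgah_mul (hsgn a) (hsgn b).
Proof.
move: a; apply: eq_linear_hpart => [c x y|c x y|p a ap].
- by rewrite dgah_mulDl dgah_mulZl linearPZ.
- by rewrite linearPZ dgah_mulDl dgah_mulZl.
move: b; apply: eq_linear_hpart => [c x y|c x y|q b bq].
- by rewrite !linearP.
- by rewrite !linearP.
rewrite (hsgn_homog (dgah_mul_homog (dgahP A) ap bq)) (hsgn_homog ap).
by rewrite (hsgn_homog bq) dgah_mulZl linearZZ scalerA sign_abszD.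
Qed.

(** The Leibniz rule for arbitrary series, with the involution in place of the
    sign. *)
Lemma dgah_leibniz_hsgn A (a b : fps (dgah_sp A)) :
  dgah_d (dgah_mul a b) = dgah_mul (dgah_d a) b + dgah_mul (hsgn a) (dgah_d b).
Proof.
move: a; apply: eq_linear_hpart => [c x y|c x y|p a ap].
- by rewrite dgah_mulDl dgah_mulZl linearPZ.
- by rewrite !linearPZ !dgah_mulDl !dgah_mulZl scalerDr addrACA.
by rewrite (dgah_leibniz (dgahP A) _ ap) (hsgn_homog ap) dgah_mulZl.
Qed.

Lemma dgah_d_mul_exact A (a b : fps (dgah_sp A)) :
  dgah_d (dgah_mul (dgah_d a) (dgah_d b)) = 0.
Proof.
by rewrite dgah_leibniz_hsgn !(dgah_dd (dgahP A)) linear0 dgah_mul0l addr0.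
Qed.

(** The degree -2 of hbar makes up for the two differentials in the
    correction term. *)
Lemma hpart_ihbar (V : gradedSpace C) (k : int) (a : fps V) :
  hpart (k + 2) a -> hpart k (ihbar R *: a).
Proof.
move=> ak n; rewrite /ihbar -scalerA fpsC_scaleE hbar_scaleE rpredZ //.
case: n => [|n]; first exact: rpred0.
by have := ak n; congr (_ \in gpart _ _); lia.
Qed.

Lemma hpartD (V : gradedSpace C) (k : int) (a b : fps V) :
  hpart k a -> hpart k b -> hpart k (a + b).
Proof. by move=> ak bk n; rewrite fpsDE rpredD. Qed.

Lemma dgah_d_deform_mul A (a b : fps (dgah_sp A)) :
  dgah_d (deform_mul a b) = dgah_d (dgah_mul a b).
Proof.
rewrite [deform_mul a b]/deform_mul linearD linearZZ /= dgah_d_mul_exact.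
by rewrite scaler0 addr0.
Qed.

(** The terms of order hbar^2 contain the differential of a product of two
    exact elements, and those of order hbar match by the Leibniz rule. *)
Lemma deform_mulA A : associative (@deform_mul R A).
Proof.
move=> a b c.
(* Only the undeformed part of an inner product survives under d. *)
have dsab : dgah_d (hsgn (deform_mul a b)) =
    dgah_mul (dgah_d (hsgn a)) (hsgn b) + dgah_mul a (dgah_d (hsgn b)).
  apply: oppr_inj; rewrite -hsgn_d dgah_d_deform_mul hsgn_d hsgn_mul.
  by rewrite dgah_leibniz_hsgn hsgnK.
have dbc : dgah_d (deform_mul b c) =
    dgah_mul (dgah_d b) c + dgah_mul (hsgn b) (dgah_d c).
  by rewrite dgah_d_deform_mul dgah_leibniz_hsgn.
rewrite {1}/deform_mul [RHS]/deform_mul dsab dbc /deform_mul.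
rewrite !linearD !linearZZ /= !dgah_mulDl !dgah_mulZl !(dgah_mulA (dgahP A)).
rewrite !scalerDr -!addrA; congr (_ + _).
by rewrite addrC -addrA.
Qed.

Lemma deform_is_dgah A : is_dgah (deform A).
Proof.
split=> /=.
- move=> b c x y; rewrite /deform_mul hsgn_linear linearPZ !dgah_mulDl.
  by rewrite !dgah_mulZl scalerDr scalerDr !scalerA mulrC addrACA.
- move=> a c x y; rewrite /deform_mul !linearPZ !scalerDr !scalerA mulrC.
  by rewrite addrACA.
- move=> p q a b ap bq; apply: hpartD.
    exact: (dgah_mul_homog (dgahP A)).
  apply: hpart_ihbar; have -> : p + q + 2 = (p + 1) + (q + 1) by lia.
  apply: (dgah_mul_homog (dgahP A)); apply: (dgah_d_homog (dgahP A)) => //.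
  by rewrite (hsgn_homog ap); apply: hpartN.
- exact: deform_mulA.
- exact: dgah_d_linear (dgahP A).
- exact: (dgah_d_homog (dgahP A)).
- exact: (dgah_dd (dgahP A)).
- move=> p a b ap; rewrite dgah_d_deform_mul (dgah_leibniz (dgahP A) _ ap).
  rewrite /deform_mul hsgn_d linearN /= !(dgah_dd (dgahP A)) oppr0 dgah_mul0l.
  by rewrite !linear0 !addr0.
Qed.

Lemma hom_hsgn (A B : dgah R) (f : dgah_hom A B) a : f (hsgn a) = hsgn (f a).
Proof.
rewrite (@hsgn_degree _ _ _ 0) ?expr0 ?scale1r // => p x xp.
by rewrite addr0; apply: dgah_hom_homog (dgah_funP f) _ _ xp.
Qed.

Lemma deform_is_dgah_hom (A B : dgah R) (f : dgah_hom A B) :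
  @is_dgah_hom R (deform A) (deform B) f.
Proof.
have [fl fh fd fm] := dgah_funP f; split=> //= a b.
by rewrite /deform_mul linearD linearZZ /= !fm !fd hom_hsgn.
Qed.
End Deform.

(** * Extension of scalars *)

Section Extend.
Variable R : realType.
Implicit Type A : dga R.

Lemma extend_is_dgah A : is_dgah (extend A).
Proof.
have [ml mr mh mA dl dh dd dL] := dgaP A.
split=> /=.
- exact: cauchy_linearl.
- exact: cauchy_linearr.
- move=> p q a b ap bq n; rewrite /cauchy rpred_sum // => i _.
  have := mh _ _ _ _ (ap i) (bq (n - i)%N); congr (_ \in gpart _ _).
  by have := ltn_ord i; lia.
- exact: cauchyA (fun u => linear_additive (ml u))
    (fun u => linear_additive (mr u)) mA.
- exact: fps_map_linear.
- move=> p a ap n; have := dh _ _ (ap n); congr (_ \in gpart _ _); lia.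
- by move=> a; apply/funext => n; apply: dd.
- move=> p a b ap; pose b' := fps_map (@dga_d R A) b.
  (* The i-th coefficient of a has degree p + 2i, hence sign (-1)^(p + 2i) in
     the Leibniz rule of A: the involution absorbs these signs all at once. *)
  have -> : (-1) ^+ `|p|%N *: cauchy (@dga_mul R A) a b' =
      cauchy (@dga_mul R A) (hsgn a) b'.
    rewrite (hsgn_homog ap); apply: esym.
    exact: (scalable_linear (cauchy_linearl ml b')).
  apply/funext => n; rewrite fpsDE /fps_map /cauchy -big_split /=.
  rewrite (big_morph _ (linear_additive dl) (linear_zero dl)).
  apply: eq_bigr => i _; rewrite (dL _ _ _ (ap i)) /hsgn (gsgn_homog (ap i)).
  by rewrite (scalable_linear (ml _)).
Qed.

Lemma fps_map_is_dgah_hom A B (f : dga_hom A B) :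
  @is_dgah_hom R (extend A) (extend B) (fps_map f).
Proof.
have [fl fh fd fm] := dga_funP f; split=> /=.
- exact: fps_map_linear.
- by move=> p a ap n; apply: fh.
- by move=> a; apply/funext => n; apply: fd.
- move=> a b; apply/funext => n; rewrite /fps_map /cauchy.
  rewrite (big_morph _ (linear_additive fl) (linear_zero fl)).
  by apply: eq_bigr => i _; rewrite fm.
Qed.

Definition extend_dgah A : dgah R := Dgah (extend_is_dgah A).

Definition extend_hom A B (f : dga_hom A B) :
  dgah_hom (extend_dgah A) (extend_dgah B) :=
  @DgahHom R (extend_dgah A) (extend_dgah B) _ (fps_map_is_dgah_hom f).
End Extend.

(** * The two functors *)

Theorem proposition1p0p2 (R : realType) :
  (exists (D0 : forall A : dgah R, is_dgah (deform A))
          (D1 : forall (A B : dgah R) (f : dgah_hom A B),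
             @is_dgah_hom R (deform A) (deform B) f),
     let F0 (A : DGAh R) : DGAh R := Dgah (D0 A) in
     let F1 (A B : DGAh R) (f : mor A B) : mor (F0 A) (F0 B) :=
       @DgahHom R (F0 A) (F0 B) (dgah_fun f) (D1 A B f) in
     is_functor F1 /\ is_faithful F1)
  /\
  (exists (D0 : forall A : dga R, is_dgah (deform (extend A)))
          (D1 : forall (A B : dga R) (f : dga_hom A B),
             @is_dgah_hom R (deform (extend A)) (deform (extend B))
               (fps_map f)),
     let F0 (A : DGA R) : DGAh R := Dgah (D0 A) in
     let F1 (A B : DGA R) (f : mor A B) : mor (F0 A) (F0 B) :=
       @DgahHom R (F0 A) (F0 B) (fps_map (dga_fun f)) (D1 A B f) in
     is_functor F1 /\ is_faithful F1).
Proof.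
split.
  exists (@deform_is_dgah R), (@deform_is_dgah_hom R) => /=.
  split; first by split=> *; apply: dgah_hom_ext.
  by move=> A B f g [fg]; apply: dgah_hom_ext.
exists (fun A => deform_is_dgah (extend_dgah A)),
  (fun A B f => deform_is_dgah_hom (extend_hom f)) => /=.
split; first by split=> *; apply: dgah_hom_ext.
move=> A B f g [fg]; apply: dga_hom_ext; apply/funext => v.
(* The constant term of the image of the constant series v is the value at v. *)
exact: (congr1 (fun h => h (fpsC v) 0%N) fg).
Qed.
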